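(* Let $K\ge 3$, let $X_1,\dots,X_K$ be compact metric spaces, and let $\mu_k\in\mathcal P(X_k)$ for $k=1,\dots,K$. Let $c:X_1\times\cdots\times X_K\to\mathbb R_+=[0,\infty)$ be continuous. Then $$\mathsf{MOT}_c(\mu_1,\dots,\mu_K)=\inf_{\pi\in\Pi(\mu_1,\dots,\mu_K)} I(\pi)=\sup_{\boldsymbol f\in\mathcal F_c}J(\boldsymbol f).$$
   Context: $\mathcal P(X)$ is the set of Borel probability measures on $X$. $\Pi(\mu_1,\dots,\mu_K)$ is the set of $\pi\in\mathcal P(X_1\times\cdots\times X_K)$ whose $k$-th marginal is $\mu_k$ for every $k$. Define $I(\pi)=\int_{X_1\times\cdots\times X_K}c\,d\pi$ and $\mathsf{MOT}_c(\mu_1,\dots,\mu_K)=\inf_{\pi\in\Pi(\mu_1,\dots,\mu_K)}I(\pi)$. For a family $\boldsymbol f=(f_1,\dots,f_K)$ with $f_k\in L^1(\mu_k)$, define $J(\boldsymbol f)=\sum_{k=1}^K\int_{X_k}f_k\,d\mu_k$. The admissible class $\mathcal F_c$ is the set of families $\boldsymbol f=(f_1,\dots,f_K)$ such that each $f_k:X_k\to\mathbb R$ is Borel with $f_k\in L^1(\mu_k)$, and $\sum_{k=1}^K f_k(x_k)\le c(x_1,\dots,x_K)$ for all $(x_1,\dots,x_K)\in X_1\times\cdots\times X_K$. *)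

(* Defs.v *)
From HB Require Import structures.
From mathcomp Require Import all_boot all_order all_algebra.
From mathcomp Require Import all_classical all_reals all_analysis.

Set Implicit Arguments.
Unset Strict Implicit.
Unset Printing Implicit Defensive.

Import Order.TTheory GRing.Theory Num.Theory.
Import numFieldNormedType.Exports.

Local Open Scope classical_set_scope.
Local Open Scope ring_scope.

(* Measurable types carry a distinguished point, so metric spaces are taken
   pointed; this only excludes the empty space, on which there is no
   probability measure. *)
#[short(type="pmetricType")]
HB.structure Definition PMetric (R : numDomainType) :=
  {M of Metric R M & Pointed M}.

Definition borel (T : ptopologicalType) : measurableType (@open T).-sigma :=
  g_sigma_algebraType (@open T).

HB.instance Definition _ (I : Type) (T : I -> ptopologicalType) :=
  isPointed.Build (prod_topology T) (fun=> point).

Section multimarginal.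
Context (R : realType) (K : nat) (X : 'I_K -> pmetricType R).

Definition prodX : ptopologicalType := prod_topology X.

Implicit Types (mu : forall k, probability (borel (X k)) R)
  (pi : probability (borel prodX) R) (c : prodX -> R)
  (f : forall k, X k -> R).

Definition coord (k : 'I_K) : borel prodX -> borel (X k) := fun x => x k.

(* Measures are functions on all subsets but only meaningful on measurable
   ones, hence the restriction to measurable A. *)
Definition couplings mu : set (probability (borel prodX) R) :=
  [set pi : probability (borel prodX) R |
    forall (k : 'I_K) (A : set (borel (X k))), measurable A ->
      pushforward pi (coord k) A = mu k A].

Local Open Scope ereal_scope.

Definition cost_functional c pi : \bar R :=
  \int[pi]_x (c x)%:E.

Definition MOT c mu : \bar R :=
  ereal_inf [set cost_functional c pi | pi in couplings mu].

Definition dual_functional mu f : \bar R :=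
  \sum_(k < K) \int[mu k]_x (f k x)%:E.

Definition admissible c mu : set (forall k, X k -> R) :=
  [set f | [/\ forall k, measurable_fun [set: borel (X k)] (f k),
      forall k, (mu k).-integrable [set: borel (X k)] (EFin \o f k)
    & forall x : prodX, (\sum_(k < K) f k (x k) <= c x)%R]].

End multimarginal.

(* Main.v *)
From Pilot Require Import Defs.
From HB Require Import structures.
From mathcomp Require Import all_boot all_order all_algebra.
From mathcomp Require Import all_classical all_reals all_analysis.
From mathcomp Require Import measurable_realfun.
From mathcomp Require Import finmap ring lra.

Set Implicit Arguments.
Unset Strict Implicit.
Unset Printing Implicit Defensive.

Import Order.TTheory GRing.Theory Num.Theory.
Import numFieldNormedType.Exports.

Local Open Scope classical_set_scope.
Local Open Scope ring_scope.

(* The inequality [sup <= inf] is integration of [\sum_k f k (x k) <= c x]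
   against a coupling. For the converse, cut every space into finitely many
   Borel cells such that [c] oscillates by less than [e / 2] on each product
   of cells. This yields a finite transportation problem with masses
   [mu k (cell)], to which Farkas' lemma applies. Functions which are constant
   on cells and feasible for the discretized cost are admissible for [c], so
   the discrete dual value is at most the supremum; an optimal discrete plan
   [p] is turned into a genuine coupling by spreading each mass [p j] over the
   box [j] proportionally to the product measure [mu_1 x ... x mu_K]. No weak
   compactness of the set of couplings is needed since the infimum only has to
   be approached. *)

(** * Farkas' lemma and duality for finite transportation problems *)

Lemma scalar_eq0 (R : pzRingType) (V : lmodType R) (f : V -> R) :
  scalar f -> f 0 = 0.
Proof.
by move=> fl; have := fl (-1) 0 0; rewrite scaler0 addr0 mulN1r addNr.
Qed.

Lemma scalar_subZ (R : pzRingType) (V : lmodType R) (f : V -> R) k x y :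
  scalar f -> f (x - k *: y) = f x - k * f y.
Proof. by move=> fl; rewrite -scaleNr addrC fl mulNr addrC. Qed.

(* Bartl's proof: induction on the number of inequalities. *)
Lemma farkas (R : realFieldType) (V : lmodType R) (I : eqType) (s : seq I)
    (a : I -> V -> R) (g : V -> R) :
  uniq s -> (forall i, scalar (a i)) -> scalar g ->
  (forall x, (forall i, i \in s -> a i x <= 0) -> g x <= 0) ->
  exists2 l : I -> R, forall i, 0 <= l i &
    forall x, g x = \sum_(i <- s) l i * a i x.
Proof.
elim: s a g => [|i s IHs] a g /=.
  move=> _ _ gl gle0; exists (fun=> 0) => // x; rewrite big_nil.
  (* Without constraints [g] is nonpositive at both [x] and [- x], hence zero. *)
  apply/le_anti; rewrite gle0//= -oppr_le0.
  have := scalar_subZ 1 0 x gl.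
  by rewrite scalar_eq0// mul1r scale1r !sub0r => <-; exact: gle0.
case/andP=> si us al gl gle0.
have upd (l : I -> R) (t : R) x :
    \sum_(j <- i :: s) (if j == i then t else l j) * a j x = t * a i x + \sum_(j <- s) l j * a j x.
  rewrite big_cons eqxx; congr (_ + _).
  rewrite [LHS]big_seq_cond [RHS]big_seq_cond; apply: eq_bigr => j.
  by rewrite andbT => js; rewrite ifN//; apply: contraNneq si => <-.
(* If the constraints in [s] already force [g <= 0], then [i] gets multiplier 0. Otherwise some [y]
   satisfies them with [0 < g y], so it must violate constraint [i]. *)
have [gle0s|/existsNP[y /not_implyP[ys gy]]] :=
  pselect (forall x, (forall j, j \in s -> a j x <= 0) -> g x <= 0).
  have [l l0 gE] := IHs _ _ us al gl gle0s.
  exists (fun j => if j == i then 0 else l j) => [j|x]; first by case: ifP.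
  by rewrite upd mul0r add0r.
have ay : 0 < a i y.
  rewrite ltNge; apply/negP => aiy; apply: gy; apply: gle0 => j.
  by rewrite inE => /predU1P[->//|]; exact: ys.
move/negP: gy; rewrite -ltNge => gy.
(* the projection onto [ker (a i)] along [y] *)
pose P x := x - (a i x / a i y) *: y.
have aPE f x : scalar f -> f (P x) = f x - a i x / a i y * f y.
  exact: scalar_subZ.
have aP0 x : a i (P x) = 0.
  by rewrite aPE// divfK ?subrr// gt_eqF.
have Pl f : scalar f -> scalar (f \o P).
  by move=> fl k x z /=; rewrite !aPE// fl (al i); ring.
have [|||x xs|l l0 gE] := IHs (fun j => a j \o P) (g \o P).
- by [].
- by move=> j; exact/Pl/al.
- exact: Pl.
- apply: gle0 => j; rewrite inE => /predU1P[->|]; first by rewrite aP0.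
  exact: xs.
(* The value forced by the desired identity at [y]; it is nonnegative since [0 < g y] while every
   [a j y] with [j] in [s] is nonpositive. *)
pose t := (g y - \sum_(j <- s) l j * a j y) / a i y.
exists (fun j => if j == i then t else l j) => [j|x].
  case: ifP => // _; rewrite /t divr_ge0 ?(ltW ay)// subr_ge0.
  rewrite (le_trans _ (ltW gy))// big_seq_cond sumr_le0// => j'.
  by rewrite andbT => j's; rewrite mulr_ge0_le0// ys.
rewrite upd; have /= := gE x; rewrite aPE// => /eqP.
rewrite subr_eq => /eqP ->.
under eq_bigr do rewrite /= aPE// mulrBr.
rewrite sumrB -addrA addrC; congr (_ + _).
under eq_bigr do rewrite mulrCA.
by rewrite -mulr_sumr /t; ring.
Qed.

(** Farkas' lemma is applied to the homogenized dual problem, whose variables are the potentials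
    [x.1] and a scale [x.2]. The multiplier of the constraint of index [j] is the mass [p j]; that
    of [0 <= x.2] is the slack in the cost bound. *)
Lemma finite_multimarginal_dual (R : realFieldType) (I T : finType)
    (m : I -> T -> R) (C : {ffun I -> T} -> R) (D : R) :
    (forall k t, 0 <= m k t) -> (forall k, \sum_t m k t = 1) ->
    (forall f : I -> T -> R, (forall j : {ffun I -> T}, \sum_k f k (j k) <= C j) ->
      \sum_k \sum_t f k t * m k t <= D) ->
  exists p : {ffun I -> T} -> R, [/\ forall j, 0 <= p j,
    forall k t, \sum_(j : {ffun I -> T} | j k == t) p j = m k t &
    \sum_j p j * C j <= D].
Proof.
move=> m0 m1 dualD.
pose V : lmodType R := ({ffun I * T -> R^o} * R^o)%type.
(* homogenized dual constraints; [None] is the constraint [0 <= t] *)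
pose a (o : option {ffun I -> T}) (x : V) : R :=
  if o is Some j then \sum_k x.1 (k, j k) - x.2 * C j else - x.2.
pose g (x : V) : R := \sum_k \sum_t x.1 (k, t) * m k t - x.2 * D.
have al o : scalar (a o).
  move=> c x y; case: o => [j|]/=; rewrite ?mulrBr ?mulr_sumr /GRing.scale/=.
    under eq_bigr do rewrite !ffunE.
    by rewrite big_split/= /GRing.scale/=; ring.
  by ring.
have gl : scalar g.
  move=> c x y; rewrite /g/=.
  have -> : \sum_k \sum_t (c *: x.1 + y.1) (k, t) * m k t =
    c * (\sum_k \sum_t x.1 (k, t) * m k t) + \sum_k \sum_t y.1 (k, t) * m k t.
    rewrite mulr_sumr -big_split/=; apply: eq_bigr => k _.
    rewrite mulr_sumr -big_split/=; apply: eq_bigr => t _.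
    by rewrite !ffunE /GRing.scale/=; ring.
  by rewrite /GRing.scale/=; ring.
have [x ax|l l0 gE] := farkas (index_enum_uniq _) al gl.
  have x2 : 0 <= x.2 by rewrite -oppr_le0; exact: (ax None (mem_index_enum _)).
  have {}ax (j : {ffun I -> T}) : \sum_k x.1 (k, j k) <= x.2 * C j.
    by rewrite -subr_le0; exact: (ax (Some j) (mem_index_enum _)).
  rewrite /g subr_le0; move: x2; rewrite le_eqVlt => /predU1P[x20|x20].
    rewrite -x20 mul0r.
    (* At scale 0 no rescaling is possible. Instead the constraint is used at the index maximizing
       each potential: a maximum dominates the average against [m k], which has total mass 1. The
       same fact shows that [T] is inhabited. *)
    have tm k : {t | forall t', x.1 (k, t') <= x.1 (k, t)}.
      have [t0 _|T0] := pickP [pred t : T | true].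
        exists [arg max_(t > t0) x.1 (k, t)]%O => t'.
        by case: arg_maxP => // t _; exact.
      move: (m1 k); rewrite big1 => [/eqP|t]; last by have := T0 t.
      by rewrite eq_sym oner_eq0.
    pose j := [ffun k => sval (tm k)].
    have := ax j; rewrite -x20 mul0r; apply: le_trans; apply: ler_sum => k _.
    rewrite -[leRHS]mulr1 -(m1 k) mulr_sumr ffunE.
    by apply: ler_sum => t _; rewrite ler_wpM2r//; case: (tm k).
  (* At positive scale, dividing by [x.2] gives feasible potentials. *)
  have := dualD (fun k t => x.1 (k, t) / x.2).
  have -> : \sum_k \sum_t x.1 (k, t) / x.2 * m k t =
      (\sum_k \sum_t x.1 (k, t) * m k t) / x.2.
    rewrite mulr_suml; apply: eq_bigr => k _; rewrite mulr_suml.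
    by apply: eq_bigr => t _; rewrite mulrAC.
  rewrite ler_pdivrMr// mulrC; apply => j.
  by rewrite -mulr_suml ler_pdivrMr// mulrC.
have gE' x : g x = - l None * x.2 + \sum_j l (Some j) * a (Some j) x.
  rewrite gE.
  rewrite (bigD1 None)//= mulNr mulrN; congr (_ + _).
  rewrite (reindex_omap (fun j => Some j) id); last by case.
  by apply: eq_bigl => j; rewrite eqxx.
exists (fun j => l (Some j)); split => //.
- move=> k t.
  (* Testing the identity on the indicator of [(k, t)] at scale 0 reads off one marginal mass. *)
  pose x : V := ([ffun kt => ((kt == (k, t))%:R : R^o)], 0).
  have := gE' x; rewrite /g /a/= mul0r subr0 mulr0 add0r.
  have -> : \sum_k0 \sum_t0 [ffun kt => (kt == (k, t))%:R] (k0, t0) * m k0 t0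
      = m k t.
    rewrite (bigD1 k)//= (bigD1 t)//= ffunE eqxx mul1r !big1 ?addr0//.
      move=> k' k'k; rewrite big1// => t' _.
      by rewrite ffunE xpair_eqE (negbTE k'k) mul0r.
    by move=> t' t't; rewrite ffunE xpair_eqE (negbTE t't) andbF mul0r.
  move=> ->; rewrite big_mkcond/=; apply: eq_bigr => j _.
  rewrite mul0r subr0 (bigD1 k)//= ffunE xpair_eqE eqxx/= big1 => [|k' k'k].
    by rewrite addr0; case: eqP; rewrite ?mulr1 ?mulr0.
  by rewrite ffunE xpair_eqE (negbTE k'k).
(* Zero potentials at scale 1 give [D] as the cost of the plan plus [l None]. *)
- have := gE' ((0, 1) : V); rewrite /g /a/= !mul1r mulr1.
  rewrite big1 ?sub0r => [|k _]; last first.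
    by rewrite big1// => t _; rewrite ffunE mul0r.
  have -> : \sum_j l (Some j) *
        (\sum_k (0 : {ffun I * T -> R^o}) (k, j k) - 1 * C j) = - \sum_j l (Some j) * C j.
    rewrite -sumrN; apply: eq_bigr => j _; rewrite big1 ?sub0r ?mul1r ?mulrN//.
    by move=> k _; rewrite ffunE.
  move/eqP; rewrite -opprD eqr_opp => /eqP ->.
  by rewrite lerDr.
Qed.

(** * Boxes in product spaces and cells of small oscillation *)

(** The product topology is the supremum of the initial topologies of the projections, so it
    suffices that the filter generated by open boxes refines each of these. *)
Lemma prod_nbhs_box (I : eqType) (X : I -> topologicalType)
    (x : prod_topology X) (U : set (prod_topology X)) : nbhs x U ->
  exists2 V : forall i, set (X i), (forall i, open_nbhs (x i) (V i)) &
    [set y | forall i, V i (y i)] `<=` U.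
Proof.
pose F : set_system (prod_topology X) :=
  filter_from [set V : forall i, set (X i) | forall i, open_nbhs (x i) (V i)]
              (fun V => [set y | forall i, V i (y i)]).
have FF : Filter F.
  apply: filter_from_filter.
    by exists (fun=> setT) => i /=; split => //; exact: openT.
  move=> V W Vx Wx; exists (fun i => V i `&` W i) => [i /=|y VWy].
    by apply: open_nbhsI; [exact: Vx|exact: Wx].
  by split => i; have [] := VWy i.
have Fx : F --> x.
  apply/cvg_sup => i A /=.
  rewrite (@nbhsE (initial_topology (fun f : forall i, X i => f i)))/=.
  move=> -[_ [[B oB <-] Bx] BA].
  exists (dfwith (fun=> setT) i B) => [j /=|y /(_ i)].
    by case: dfwithP => // k _; split => //; exact: openT.
  by rewrite dfwithin => By; exact: BA.
by move=> /Fx [V Vx VU]; exists V.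
Qed.

Lemma open_box (I : finType) (X : I -> topologicalType)
    (V : forall i, set (X i)) : (forall i, open (V i)) ->
  open ([set y | forall i, V i (y i)] : set (prod_topology X)).
Proof.
move=> oV; rewrite openE => y Vy.
apply: (@filter_forall _ _ (fun i => [set y | V i (y i)]) (nbhs y)) => i.
apply: (@proj_continuous I X i y (V i)).
by apply: open_nbhs_nbhs; split; [exact: oV|exact: Vy].
Qed.

(* The cells are the atoms of the finite algebras generated by the sides of
   finitely many open boxes covering the product, on each of which [c]
   oscillates little. *)
Lemma oscillation_cells (R : realType) (J : finType) (X : J -> ptopologicalType)
    (c : prod_topology X -> R) (e : R) :
  compact [set: prod_topology X] -> continuous c -> 0 < e ->
  exists (T : finType) (q : forall i, X i -> T),
    (forall i t, measurable (q i @^-1` [set t] : set (borel (X i)))) /\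
    (forall x y : prod_topology X, (forall i, q i (x i) = q i (y i)) ->
      `|c x - c y| < e).
Proof.
move=> cX cc e0.
(* The radius is [e / 2] because two points of a box are compared through its centre. *)
have W (x : prod_topology X) : {V : forall i, set (X i) |
    (forall i, open_nbhs (x i) (V i)) &
    forall y, (forall i, V i (y i)) -> `|c x - c y| < e / 2}.
  apply/cid2; have : nbhs x [set y | `|c x - c y| < e / 2].
    by move/cvgrPdist_lt : (cc x) => /(_ (e / 2)); apply; rewrite divr_gt0.
  exact: prod_nbhs_box.
pose V x := s2val (W x).
have oV x i : open (V x i) by case: (s2valP (W x) i).
have Vx x i : V x i (x i) by case: (s2valP (W x) i).
have Vc x y : (forall i, V x i (y i)) -> `|c x - c y| < e / 2.
  exact: (s2valP' (W x)).
move: cX; rewrite compact_cover.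
move=> /(_ _ setT (fun x => [set y | forall i, V x i (y i)])).
case => [x _|x _|s _ scov].
- exact: open_box.
- by exists x => // i; exact: Vx.
(* The label of [z] is the set of centres [a] of the finite cover whose [i]-th side contains [z];
   points with equal labels therefore lie in the same boxes. *)
exists {set s}, (fun i z => [set a : s | `[< V (fsval a) i z >]])%SET.
split => [i t|x y xy].
- rewrite [X in measurable X](_ : _ = \bigcap_(a in [set: s])
    if a \in t then V (fsval a) i else ~` V (fsval a) i); last first.
    apply/seteqP; split => z /=.
      by move=> <- a _; rewrite inE; case: asboolP.
    move=> zt; apply/setP => a; rewrite inE; move: (zt a I).
    by case: (a \in t) => // ?; apply/asboolP.
  apply: fin_bigcap_measurable => [|a _]; first exact: finite_finset.
  case: ifP => _; last apply: measurableC; exact: sub_sigma_algebra.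
- have [a sa Va] := scov x I.
  have Vay i : V a i (y i).
    have := xy i => /setP/(_ [` sa]%fset); rewrite !inE/= => xya.
    by apply/asboolP; rewrite -xya; exact/asboolP/Va.
  have -> : c x - c y = (c a - c y) - (c a - c x) by ring.
  by rewrite (le_lt_trans (ler_normB _ _))// [e]splitr ltrD// Vc.
Qed.

(** * Product measures on the Borel sets of a product space *)

(** The Borel sets of the product are generated by all open sets, not only by boxes. Countable bases
    of the factors write each open set as a countable union of boxes, whose preimages are finite
    intersections of measurable sets. *)
Lemma measurable_fun_prod_topology (d : measure_display) (W : measurableType d)
    (I : finType) (X : I -> ptopologicalType) (Z : W -> prod_topology X) :
  (forall i, @second_countable (X i)) ->
  (forall i, measurable_fun setT (fun w => Z w i : borel (X i))) ->
  measurable_fun setT (Z : W -> borel (prod_topology X)).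
Proof.
move=> /(_ _)/cid2-/all_sig2[B cB bB] mZ.
apply: (@measurability _ _ _ (borel (prod_topology X)) setT Z
  (@open (prod_topology X))) => //.
move=> _ [G oG <-]; rewrite setTI.
have /(_ _)/cid-/all_sig[b bP] i : exists b : nat -> set (X i),
    (forall n, open (b n)) /\ forall U, B i U -> exists n, b n = U.
  have /countable_injP[f f_inj] := cB i.
  have [Bo _] := bB i.
  (* Indices that code no basic set are sent to [set0], which is open. *)
  exists (fun n => xget set0 [set U | B i U /\ f U = n]); split=> [n|U BU].
    by case: xgetP => [U -> [/Bo]//|_]; exact: open0.
  exists (f U); apply: xget_subset1 => // V V' [BV fV] [BV' fV'].
  by apply: f_inj; [exact: mem_set|exact: mem_set|rewrite fV fV'].
(* [G] is a countable union of boxes with sides in the countable bases *)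
rewrite [X in measurable X](_ : _ = \bigcup_(n : {ffun I -> nat})
    if `[< [set y : prod_topology X | forall i, b i (n i) (y i)] `<=` G >]
    then \bigcap_(i in [set: I]) (fun w => Z w i) @^-1` b i (n i)
    else set0); last first.
  apply/seteqP; split => [w /= GZw|w [n _]]; last first.
    by case: asboolP => // nG nw; apply: nG => i; exact: nw.
  have [V Vw VG] : exists2 V : forall i, set (X i),
      (forall i, open_nbhs (Z w i) (V i)) & [set y | forall i, V i (y i)] `<=` G.
    by apply: prod_nbhs_box; exact: open_nbhs_nbhs.
  have /(_ _)/cid-/all_sig[n nP] i : exists n, b i n (Z w i) /\ b i n `<=` V i.
    have [_ /(_ (Z w i) (V i)) BV] := bB i.
    have [U [BU Uw] UV] := BV (open_nbhs_nbhs (Vw i)).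
    by have [_ /(_ _ BU)[n nU]] := bP i; exists n; rewrite nU.
  exists (finfun n) => //; case: asboolP => [_ i _ /=|nG].
    by rewrite ffunE; case: (nP i).
  exfalso; apply: nG => y nGy; apply: VG => i.
  by case: (nP i) => _; apply; have := nGy i; rewrite ffunE.
apply: countable_bigcupT_measurable => [|n]; first exact: countableP.
case: asboolP => // _; apply: fin_bigcap_measurable => [|i _].
  exact: finite_finset.
rewrite -[X in measurable X]setTI; apply: mZ => //.
by apply: sub_sigma_algebra; case: (bP i).
Qed.

(** One binary product measure is taken per index of [s]; coordinates outside [s] keep the default
    value [point]. *)
Lemma independent_family (R : realType) (I : eqType) (X : I -> ptopologicalType)
    (mu : forall i, probability (borel (X i)) R) (s : seq I) : uniq s ->
  exists (d : measure_display) (W : measurableType d) (Q : probability W R)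
      (Z : W -> forall i, X i),
    (forall i, measurable_fun setT (fun w => Z w i : borel (X i))) /\
    forall A : forall i, set (borel (X i)), (forall i, measurable (A i)) ->
      Q [set w | forall i, i \in s -> A i (Z w i)] =
      (\prod_(i <- s) mu i (A i))%E.
Proof.
elim: s => [|i s IHs] /=.
  exists _, unit, (dirac tt), (fun _ _ => point); split => [i|A mA].
    exact: measurable_cst.
  by rewrite big_nil /= /dirac indicE mem_set.
case/andP => si /IHs[d [W [Q [Z [mZ QE]]]]].
(* The fresh factor overwrites coordinate [i]; as [i] is not in [s], the coordinates already built
   are intact. *)
exists _, (W * borel (X i))%type, (Q \x mu i)%E,
  (fun wx => dfwith (Z wx.1) i wx.2).
split=> [j|A mA].
  have [->|ij] := eqVneq i j.
    by under eq_fun do rewrite dfwithin; exact: measurable_snd.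
  under eq_fun do rewrite dfwithout//.
  exact: measurableT_comp (mZ j) measurable_fst.
pose S := [set w | forall j, j \in s -> A j (Z w j)].
transitivity ((Q \x mu i)%E (S `*` A i)).
  congr (_ _).
  apply/seteqP; split=> [[w x] /= wxA|[w x] [/= wA xA] j].
    split=> [j js|]; last by have := wxA i; rewrite mem_head dfwithin; exact.
    have ij : i != j by apply: contraNneq si => ->.
    by have := wxA j; rewrite inE js orbT dfwithout//; exact.
  rewrite inE; have [<-|ij] := eqVneq i j; first by rewrite dfwithin.
  by rewrite /= dfwithout//; exact: wA.
have mS : measurable S.
  rewrite [X in measurable X](_ : _ = \bigcap_(j in [set` s])
    (fun w => Z w j) @^-1` A j); last first.
    by apply/seteqP; split => w Sw j js; exact: Sw.
  apply: fin_bigcap_measurable => [|j _]; first exact: finite_seq.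
  by rewrite -[X in measurable X]setTI; exact: (mZ j measurableT _ (mA j)).
rewrite (product_measure1E _ _ mS (mA i)).
by rewrite big_cons muleC; congr (_ * _)%E; exact: QE.
Qed.

(** This is the joint law of an independent family indexed by all of [I]. *)
Lemma product_probability (R : realType) (I : finType) (X : I -> ptopologicalType)
    (mu : forall i, probability (borel (X i)) R) :
  (forall i, @second_countable (X i)) ->
  exists P : probability (borel (prod_topology X)) R,
    forall A : forall i, set (borel (X i)), (forall i, measurable (A i)) ->
      P [set x | forall i, A i (x i)] = (\prod_i mu i (A i))%E.
Proof.
move=> scX; have [d [W [Q [Z [mZ QE]]]]] := independent_family mu (index_enum_uniq I).
have mZ' := measurable_fun_prod_topology scX mZ.
pose fZ : {mfun W >-> borel (prod_topology X)} :=
  HB.pack (Z : W -> borel (prod_topology X)) (isMeasurableFun.Build _ _ _ _ _ mZ').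
exists (distribution Q fZ) => A mA.
rewrite -QE// /distribution /pushforward; congr (Q _).
by apply/seteqP; split => w /= wA i //; apply: wA; rewrite mem_index_enum.
Qed.

(** * Couplings with prescribed masses on boxes *)

Lemma measure_preimage_sum (d : measure_display) (W : measurableType d)
    (R : realType) (mu : {measure set W -> \bar R}) (T : finType) (q : W -> T)
    (A : set W) :
  measurable A -> (forall t, measurable (q @^-1` [set t])) ->
  mu A = (\sum_t mu (A `&` q @^-1` [set t]))%E.
Proof.
move=> mA mq; rewrite fsbig_seq ?index_enum_uniq//.
rewrite -measure_fin_bigcup//.
- congr (mu _); apply/seteqP; split => [x Ax|x [t _ []//]].
  by exists (q x) => //=; rewrite mem_index_enum.
- exact: trivIset_preimage1_in.
- by move=> t _; exact: measurableI.
Qed.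

Lemma ex_measure_sum (d : measure_display) (W : measurableType d)
    (R : realType) (J : Type) (s : seq J) (nu : J -> {measure set W -> \bar R}) :
  exists M : {measure set W -> \bar R}, forall A, M A = (\sum_(j <- s) nu j A)%E.
Proof.
elim: s => [|j s [M ME]]; first by exists mzero => A; rewrite big_nil.
by exists (measure_add (nu j) M) => A; rewrite big_cons -ME; exact: measure_addE.
Qed.

Lemma measurable_proj (I : eqType) (X : I -> ptopologicalType) (i : I) :
  measurable_fun setT (fun x : borel (prod_topology X) => x i : borel (X i)).
Proof.
apply: (@measurability _ _ _ (borel (X i)) setT _ (@open (X i))) => //.
move=> _ [U oU <-]; rewrite setTI; apply: sub_sigma_algebra.
by apply: open_comp => // x _; exact: (@proj_continuous I X i).
Qed.

Lemma measurable_box (I : finType) (X : I -> ptopologicalType)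
    (A : forall i, set (borel (X i))) : (forall i, measurable (A i)) ->
  measurable ([set x | forall i, A i (x i)] : set (borel (prod_topology X))).
Proof.
move=> mA; rewrite [X in measurable X](_ : _ = \bigcap_(i in [set: I])
  (fun x : borel (prod_topology X) => x i : borel (X i)) @^-1` A i); last first.
  by apply/seteqP; split => x Ax i; [move=> _|]; exact: Ax.
apply: fin_bigcap_measurable => [|i _]; first exact: finite_finset.
by rewrite -[X in measurable X]setTI; exact: (measurable_proj measurableT (mA i)).
Qed.

(* The coupling has density [p j / \prod_i mu i (cell j i)] with respect to the
   product measure on the box of index [j]; the quotient is [0 / 0 = 0] on
   null boxes, where [p] vanishes because of its marginals. *)
Lemma coupling_of_cells (R : realType) (I T : finType) (i0 : I)
    (X : I -> ptopologicalType) (mu : forall i, probability (borel (X i)) R)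
    (q : forall i, X i -> T) (p : {ffun I -> T} -> R) :
  (forall i, @second_countable (X i)) ->
  (forall i t, measurable (q i @^-1` [set t] : set (borel (X i)))) ->
  (forall j, 0 <= p j) ->
  (forall i t, (\sum_(j : {ffun I -> T} | j i == t) p j)%:E
     = mu i (q i @^-1` [set t])) ->
  exists pi : probability (borel (prod_topology X)) R,
    (forall i (A : set (borel (X i))), measurable A ->
       pi [set x | A (x i)] = mu i A) /\
    (forall j : {ffun I -> T}, pi [set x | forall i, q i (x i) = j i] = (p j)%:E).
Proof.
move=> scX mq p0 pE; have [P PE] := product_probability mu scX.
pose m i t := \sum_(j : {ffun I -> T} | j i == t) p j.
have mE i t : (m i t)%:E = mu i (q i @^-1` [set t]) by exact: pE.
pose w j := p j / \prod_i m i (j i).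
have m0 i t : 0 <= m i t by exact: sumr_ge0.
have w0 j : 0 <= w j by rewrite divr_ge0// prodr_ge0.
pose E (j : {ffun I -> T}) : set (borel (prod_topology X)) :=
  [set x | forall i, q i (x i) = j i].
have mEj j : measurable (E j) by exact: (measurable_box (fun i => mq i (j i))).
have [M ME] := ex_measure_sum (enum {ffun I -> T})
  (fun j => mscale (NngNum (w0 j)) (mrestr P (mEj j))).
have {}ME A : M A = (\sum_j (w j)%:E * P (A `&` E j))%E.
  by rewrite ME big_enum.
have p_le i j : p j <= m i (j i).
  by rewrite /m (bigD1 j)//= lerDl sumr_ge0.
have marg i (A : set (borel (X i))) : measurable A -> M [set x | A (x i)] = mu i A.
  move=> mA.
  pose r t := fine (mu i (A `&` q i @^-1` [set t])).
  have rE t : mu i (A `&` q i @^-1` [set t]) = (r t)%:E.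
    by rewrite fineK// fin_num_measure//; apply: measurableI.
  have PEj j : P ([set x | A (x i)] `&` E j) =
      (r (j i) * \prod_(k | k != i) m k (j k))%:E.
    (* Intersecting with the cylinder over [A] changes only side [i] of the box. *)
    pose B := dfwith (fun k => q k @^-1` [set j k] : set (borel (X k))) i
      (A `&` q i @^-1` [set j i]).
    have mB k : measurable (B k).
      by rewrite /B; case: dfwithP => // *; exact: measurableI.
    transitivity (P [set x | forall k, B k (x k)]).
      congr (P _); apply/seteqP; split => [x [/= Ax Ex] k|x Bx /=].
        rewrite /B; have [<-|ik] := eqVneq i k.
          by rewrite dfwithin; split => //; exact: Ex.
        by rewrite dfwithout//; exact: Ex.
      split; first by have := Bx i; rewrite /B dfwithin => -[].
      move=> k; have [<-|ik] := eqVneq i k.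
        by have := Bx i; rewrite /B dfwithin => -[].
      by have := Bx k; rewrite /B dfwithout.
    rewrite PE// (bigD1 i)//= {1}/B dfwithin rE EFinM; congr (_ * _)%E.
    rewrite -prodEFin; apply: eq_bigr => k ki.
    by rewrite /B dfwithout 1?eq_sym// mE.
  rewrite ME (measure_preimage_sum _ mA (mq i)).
  under eq_bigr do rewrite PEj -EFinM.
  rewrite [RHS](eq_bigr (fun t => (r t)%:E)); last by move=> t _; exact: rE.
  rewrite !sumEFin; congr (_%:E).
  have r_le t : r t <= m i t.
    rewrite -lee_fin -rE mE; apply: le_measure.
    - by apply: mem_set; exact: measurableI.
    - exact: mem_set.
    - exact: subIsetr.
  transitivity (\sum_j p j * (r (j i) / m i (j i))).
    apply: eq_bigr => j _; have [mj0|mj0] := eqVneq (\prod_k m k (j k)) 0.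
      suff pj0 : p j = 0 by rewrite /w pj0 !mul0r.
      apply/le_anti; rewrite p0 andbT.
      by move/eqP: mj0 => /prodf_eq0[k _ /eqP <-]; exact: p_le.
    move: mj0; rewrite /w (bigD1 i)//= mulf_eq0 negb_or => /andP[mi mk].
    by field; rewrite mi.
  (* Grouping by the [i]-th label lets the masses [p j] add up to [m i t], which cancels the
     denominator. *)
  rewrite (partition_big (fun j : {ffun I -> T} => j i) predT)//=.
  apply: eq_bigr => t _.
  transitivity (m i t * (r t / m i t)).
    by rewrite /m mulr_suml; apply: eq_bigr => j /eqP <-.
  (* On a null cell the quotient is 0, and so is [r t], being at most [m i t]. *)
  have [mt0|mt0] := eqVneq (m i t) 0; last by rewrite mulrC divfK.
  rewrite mt0 mul0r; apply/le_anti; rewrite -{2}mt0 r_le andbT.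
  by rewrite /r fine_ge0.
(* The total mass is read off the marginal at [i0], so normalizing [M] only bundles it as a
   probability. *)
have M1 : M setT = 1%E.
  by rewrite -(probability_setT (mu i0)) -(marg i0 setT measurableT).
have MnE A : mnormalize M P A = M A.
  by rewrite /mnormalize M1 onee_eq0/= invr1 mule1.
exists (mnormalize M P); split => [i A mA|j]; first by rewrite -marg//; exact: MnE.
transitivity (M (E j)); first exact: MnE.
have PEj : P (E j) = (\prod_i m i (j i))%:E.
  rewrite -prodEFin; transitivity (\prod_i mu i (q i @^-1` [set j i]))%E.
    by apply: (PE (fun i => q i @^-1` [set j i])) => i; exact: mq.
  by apply: eq_bigr => i _; exact/esym/mE.
(* Boxes with distinct indices are disjoint, so only the term [j] survives. *)
rewrite ME (bigD1 j)//= setIid PEj -EFinM [X in (_ + X)%E]big1 ?adde0 => [|j' j'j].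
  congr (_%:E); rewrite /w; have [mj0|mj0] := eqVneq (\prod_k m k (j k)) 0.
    rewrite mj0 mulr0; apply/le_anti; rewrite p0/=.
    by move/eqP: mj0 => /prodf_eq0[k _ /eqP <-]; exact: p_le.
  by rewrite divfK.
rewrite [X in P X](_ : _ = set0) ?measure0 ?mule0//.
apply/seteqP; split => // x [Ej Ej']; move/eqP: j'j; apply.
by apply/ffunP => i; rewrite -Ej Ej'.
Qed.

(** * Integration of step functions and measurability of continuous costs *)

(** Serves twice: for potentials constant on cells, and for the step function bounding the cost. *)
Lemma integral_finite_valued (d : measure_display) (W : measurableType d)
    (R : realType) (P : probability W R) (T : finType) (q : W -> T) (g : T -> R) :
  (forall t, measurable (q @^-1` [set t])) ->
  [/\ measurable_fun setT (g \o q), P.-integrable setT (EFin \o (g \o q)) &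
    (\int[P]_x (g (q x))%:E = \sum_t (g t)%:E * P (q @^-1` [set t]))%E].
Proof.
move=> mq.
have mgq (h : T -> R) : measurable_fun setT (h \o q).
  move=> _ Y mY; rewrite setTI.
  rewrite [X in measurable X](_ : _ = \bigcup_(t in h @^-1` Y) q @^-1` [set t]).
    by apply: fin_bigcup_measurable => [|t _]; [exact: finite_finset|exact: mq].
  by apply/seteqP; split => [x Yx|x [t Yt /= ->//]]; exists (q x).
have igq (h : T -> R) : P.-integrable setT (EFin \o (h \o q)).
  apply: measurable_bounded_integrable => //.
    by rewrite (le_lt_trans (probability_le1 P measurableT))// ltry.
  exists (\sum_t `|h t|); split; first exact: num_real.
  move=> M hM x _; apply: (le_trans _ (ltW hM)).
  by rewrite (bigD1 (q x))//= lerDl sumr_ge0.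
split => //.
transitivity (\int[P]_x \sum_(t <- index_enum T)
    ((g t)%:E * (\1_(q @^-1` [set t]) x)%:E))%E.
  apply: eq_integral => x _; rewrite (bigD1 (q x))//= indicE mem_set// mule1.
  rewrite big1 ?adde0// => t tq; rewrite indicE memNset ?mule0// => /= qt.
  by rewrite qt eqxx in tq.
have i1 t : P.-integrable setT (fun x => (\1_(q @^-1` [set t]) x)%:E).
  rewrite (_ : (fun x => _) = EFin \o ((fun t' => (t' == t)%:R) \o q)).
    exact: igq.
  apply/funext => x /=; rewrite indicE; congr (((nat_of_bool _)%:R)%:E).
  by apply/idP/eqP => [/set_mem|qt]; last exact/mem_set.
rewrite integral_sum//; last by move=> t; exact: integrableZl.
by apply: eq_bigr => t _; rewrite integralZl// integral_indic// setIT.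
Qed.

Lemma continuous_measurable_borel (R : realType) (X : ptopologicalType)
    (c : X -> R) : continuous c -> measurable_fun setT (c : borel X -> R).
Proof.
move=> cc; apply: (measurability _ (RGenOpens.measurableE R)).
move=> _ [_ [a [b ->] <-]]; rewrite setTI; apply: sub_sigma_algebra.
by apply: open_comp => [x _|]; [exact: cc|exact: interval_open].
Qed.

(** * The two inequalities between the primal and dual values *)

Section duality.
Context (R : realType) (K : nat) (X : 'I_K -> pmetricType R)
  (mu : forall k, probability (borel (X k)) R) (c : prodX X -> R).
Hypotheses (c_cont : continuous c) (c_ge0 : forall x, 0 <= c x).

Let mc : measurable_fun setT (EFin \o (c : borel (prodX X) -> R)).
Proof. by apply/measurable_EFinP; exact: continuous_measurable_borel. Qed.

Lemma dual_le_cost f pi : admissible c mu f -> couplings mu pi ->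
  (dual_functional mu f <= cost_functional c pi)%E.
Proof.
move=> [mf intf fc] pimu.
have mcoord k : measurable_fun setT (@Defs.coord R K X k) by exact: measurable_proj.
pose Z k : {mfun borel (prodX X) >-> borel (X k)} :=
  HB.pack (@Defs.coord R K X k) (isMeasurableFun.Build _ _ _ _ _ (mcoord k)).
have distE k A : measurable A -> A `<=` setT -> distribution pi (Z k) A = mu k A.
  by move=> mA _; exact: pimu.
have mEf k : measurable_fun setT (EFin \o (f k : borel (X k) -> R)).
  exact/measurable_EFinP.
have ifZ k : pi.-integrable setT ((EFin \o f k) \o @Defs.coord R K X k).
  apply/integrableP; split; first exact: measurableT_comp (mEf k) (mcoord k).
  have /integrableP[_] := intf k; apply: le_lt_trans.
  rewrite -(eq_measure_integral _ (distE k)).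
  by rewrite ge0_integral_pushforward//; exact: measurableT_comp.
have -> : dual_functional mu f =
    (\sum_(k < K) \int[pi]_x ((EFin \o f k) \o @Defs.coord R K X k) x)%E.
  apply: eq_bigr => k _; rewrite -(eq_measure_integral _ (distE k)).
  by rewrite integral_pushforward//; exact: ifZ.
rewrite -(integral_sum measurableT ifZ).
(* An infinite cost makes the bound trivial; a finite one makes the nonnegative [c] integrable. *)
have [/eqP|cfin] := eqVneq (cost_functional c pi) +oo%E.
  by move=> /eqP ->; rewrite leey.
apply: (le_integral measurableT).
- by apply: (integrable_sum measurableT) => k _; exact: ifZ.
- apply/integrableP; split=> //.
  under eq_integral do rewrite /= ger0_norm//.
  by rewrite ltey.
- by move=> x _; rewrite /= sumEFin lee_fin; exact: fc.
Qed.

Hypotheses (K_gt0 : (0 < K)%N) (cX : forall k, compact [set: X k]).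

Lemma primal_le_dual_eps (s e : R) : 0 < e ->
  (forall f, admissible c mu f -> (dual_functional mu f <= s%:E)%E) ->
  exists2 pi, couplings mu pi & (cost_functional c pi <= (s + e)%:E)%E.
Proof.
move=> e0 dual_le; have e20 : 0 < e / 2 by rewrite divr_gt0.
have cprod : compact [set: prodX X].
  have := tychonoff cX; congr (compact _).
  by apply/seteqP; split.
have [T [q [mq qc]]] := oscillation_cells cprod c_cont e20.
pose m k t := fine (mu k (q k @^-1` [set t])).
have mE k t : mu k (q k @^-1` [set t]) = (m k t)%:E.
  by rewrite /m fineK// fin_num_measure//; exact: mq.
have m0 k t : 0 <= m k t by exact: fine_ge0.
have m1 k : \sum_t m k t = 1.
  apply: EFin_inj; rewrite -sumEFin -(probability_setT (mu k)).
  rewrite (measure_preimage_sum _ measurableT (mq k)).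
  by apply: eq_bigr => t _; rewrite setTI; exact/esym/mE.
pose Q (x : prodX X) : {ffun 'I_K -> T} := [ffun k => q k (x k)].
(* A sample value of [c] on box [j], lowered by [e / 2] so that [C (Q x) < c x < C (Q x) + e]: the
   left bound makes discrete potentials admissible, the right one controls the cost. On an empty box
   the sample is taken at [point], harmlessly since [p j] is then 0. *)
pose C j := c (xget point (Q @^-1` [set j])) - e / 2.
have cC x : `|c x - (C (Q x) + e / 2)| < e / 2.
  rewrite subrK; apply: qc => k.
  have : (Q @^-1` [set Q x]) (xget point (Q @^-1` [set Q x])).
    by exact: (xgetPex _ (ex_intro _ x erefl)).
  by move=> /ffunP/(_ k); rewrite !ffunE.
have [phi phiC|p [p0 pm pC]] := @finite_multimarginal_dual R _ T m C s m0 m1.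
  pose f k : X k -> R := phi k \o q k.
  have fP k := integral_finite_valued (mu k) (phi k) (mq k).
  rewrite -lee_fin; apply: (le_trans _ (dual_le f _)).
    rewrite /dual_functional -sumEFin; apply: lee_sum => k _.
    have [_ _ ->] := fP k; rewrite -sumEFin; apply: lee_sum => t _.
    by rewrite mE EFinM.
  split => [k|k|x]; [by have [] := fP k|by have [] := fP k|].
  have /(_ (Q x)) := phiC; under eq_bigr do rewrite ffunE.
  move=> /le_trans; apply.
  by have := cC x; rewrite ltr_norml => /andP[h1 h2]; lra.
have scX k : @second_countable (X k).
  by exact: (@compact_second_countable R (X k) (cX (k:=k))).
have pmu k t : (\sum_(j : {ffun 'I_K -> T} | j k == t) p j)%:E =
    mu k (q k @^-1` [set t]).
  by rewrite pm mE.
have [pi [pimu pibox]] := coupling_of_cells (Ordinal K_gt0) scX mq p0 pmu.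
exists pi; first by move=> k A mA; exact: pimu.
have QE j : Q @^-1` [set j] = [set x | forall k, q k (x k) = j k].
  apply/seteqP; split => x /= => [<- k|xj]; first by rewrite ffunE.
  by apply/ffunP => k; rewrite ffunE.
have mQ j : measurable (Q @^-1` [set j] : set (borel (prodX X))).
  by rewrite QE; exact: (measurable_box (fun k => mq k (j k))).
have [mg _ gE] := integral_finite_valued pi (fun j => C j + e) mQ.
have cg x : c x <= C (Q x) + e.
  by have := cC x; rewrite ltr_norml => /andP[h1 h2]; lra.
(* Replacing [c] by the step function [C + e] costs at most [e], as the masses [p j] sum to 1. *)
apply: (@le_trans _ _ (\int[pi]_x (C (Q x) + e)%:E)%E).
  apply: ge0_le_integral => //.
  - by move=> x _; rewrite lee_fin (le_trans (c_ge0 x)).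
  - exact/measurable_EFinP.
  - by move=> x _; rewrite lee_fin.
rewrite gE.
under eq_bigr do rewrite QE pibox -EFinM.
rewrite sumEFin lee_fin.
under eq_bigr do rewrite mulrDl.
rewrite big_split/= -mulr_sumr.
have -> : \sum_j p j = 1.
  rewrite -(m1 (Ordinal K_gt0)).
  rewrite (partition_big (fun j : {ffun 'I_K -> T} => j (Ordinal K_gt0)) predT)//=.
  by apply: eq_bigr => t _; rewrite pm.
rewrite mulr1 lerD2r; apply: le_trans pC.
by apply: ler_sum => j _; rewrite mulrC.
Qed.

End duality.

Theorem theorem1 (R : realType) (K : nat) (hK : (3 <= K)%N)
    (X : 'I_K -> pmetricType R)
    (cX : forall k, compact [set: X k])
    (mu : forall k, probability (borel (X k)) R)
    (c : prodX X -> R) (c_cont : continuous c) (c_ge0 : forall x, 0 <= c x) :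
  MOT c mu = ereal_inf [set cost_functional c pi | pi in couplings mu] /\
  ereal_inf [set cost_functional c pi | pi in couplings mu]
    = ereal_sup [set dual_functional mu f | f in admissible c mu].
Proof.
split => //; apply/le_anti/andP; split; last first.
  apply: ge_ereal_sup => _ [f fadm <-]; apply/ereal_infP => _ [pi pimu <-].
  exact: dual_le_cost.
set S := ereal_sup _.
have S_ub f : admissible c mu f -> (dual_functional mu f <= S)%E.
  by move=> fadm; apply: ereal_sup_ubound; exists f.
(* The zero family is admissible because [c] is nonnegative; hence [S] is either [+oo] or real. *)
have S0 : (0 <= S)%E.
  apply: le_trans (S_ub (fun _ _ => 0) _).
    by rewrite /dual_functional big1// => k _; rewrite integral0.
  split => [k|k|x]; [exact: measurable_cst|exact: integrable0|by rewrite big1].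
have [S_oo|S_fin] := eqVneq S +oo%E; first by rewrite S_oo leey.
have SE : S = (fine S)%:E by rewrite fineK// ge0_fin_numE// ltey.
apply/lee_addgt0Pr => e e0; rewrite SE -EFinD.
have [f fadm|pi pimu] := @primal_le_dual_eps R K X mu c c_cont c_ge0
  (leq_trans (isT : 0 < 3)%N hK) cX (fine S) e e0; first by rewrite -SE; exact: S_ub.
by apply: le_trans; apply: ereal_inf_lbound; exists pi.
Qed.
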